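(* For all reals $\delta,\sigma,b>0$ with $b \le \delta\sigma/30$ there is $n_0=n_0(\delta,\sigma,b)>0$ such that, for all integers $n \ge n_0$, $2 \le r \le b\log n$, $n^{1+\sigma} \le m \le n^{r n^{\sigma/5}}$ and all reals $D>0$, the following holds for every $n$-vertex $r$-uniform hypergraph $\mathcal H$ satisfying $$ \max_{v\in V(\mathcal H)}|\deg_{\mathcal H}(v)-D|\le n^{-\sigma}D \qquad\text{and}\qquad \max_{u\neq v\in V(\mathcal H)}\deg_{\mathcal H}(u,v)\le n^{-\sigma}D. $$ We have $$ \Pr\bigl(\chi'(\mathcal H_m) \le (1+\delta)\,r m/n\bigr) \;\ge\; 1-m^{-\omega(r)}, $$ where $\mathcal H_m$ denotes the random subhypergraph of $\mathcal H$ with edges $e_1,\dots,e_m$, where each edge $e_i$ is independently chosen uniformly at random from the edges of $\mathcal H$.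
   Context: $\log$ is the natural logarithm. A hypergraph is $r$-uniform if each of its edges is a set of exactly $r$ vertices. Degrees and codegrees are $\deg_{\mathcal H}(v)=|\{e\in E(\mathcal H): v\in e\}|$ and $\deg_{\mathcal H}(u,v)=|\{e\in E(\mathcal H):\{u,v\}\subseteq e\}|$. The chromatic index $\chi'(\mathcal H)$ is the smallest number of colors needed to properly color the edges of $\mathcal H$, i.e., so that no two intersecting edges receive the same color. In $\mathcal H_m$ the edges $e_1,\dots,e_m$ may contain repetitions; repeated occurrences of an edge are treated as separate (intersecting) edges, so they must receive different colors. Asymptotic notation is as $n\to\infty$: the bound $1-m^{-\omega(r)}$ means $1-m^{-\psi(n)\, r}$ for some function $\psi(n)\to\infty$ that depends only on $\delta,\sigma,b$ (so the bound is uniform over all admissible $r,m,D,\mathcal H$). *)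

(* Defs.v *)
From mathcomp Require Import all_boot all_order all_algebra.

Set Implicit Arguments.
Unset Strict Implicit.
Unset Printing Implicit Defensive.

Import GRing.Theory.

(* A hypergraph with vertex type V is its edge set H : {set {set V}}. *)

Definition uniform_hypergraph (V : finType) (r : nat) (H : {set {set V}}) : Prop :=
  forall e : {set V}, e \in H -> #|e| = r.

Definition hdeg (V : finType) (H : {set {set V}}) (v : V) : nat :=
  #|[set e in H | v \in e]|.

Definition hcodeg (V : finType) (H : {set {set V}}) (u v : V) : nat :=
  #|[set e in H | [set u; v] \subset e]|.

(* A family t of edges is indexed by 'I_m, so that repeated edges are kept apart:
   colors are given to indices, and equal (nonempty) edges at distinct indices
   intersect, hence need different colors. *)
Definition edge_colorable (V : finType) (m : nat) (t : {ffun 'I_m -> {set V}})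
    (k : nat) : bool :=
  [exists c : {ffun 'I_m -> 'I_k},
    [forall i, forall j,
      (i != j) && ~~ [disjoint t i & t j] ==> (c i != c j)]].

Lemma edge_colorable_exists (V : finType) (m : nat)
    (t : {ffun 'I_m -> {set V}}) : exists k, edge_colorable t k.
Proof.
exists m; apply/existsP; exists [ffun i => i].
by apply/forallP=> i; apply/forallP=> j; rewrite !ffunE; apply/implyP=> /andP[].
Qed.

Definition chromatic_index (V : finType) (m : nat)
    (t : {ffun 'I_m -> {set V}}) : nat :=
  ex_minn (edge_colorable_exists t).

Local Open Scope ring_scope.

Definition uniform_edge_pmf (R : numFieldType) (V : finType)
    (H : {set {set V}}) (e : {set V}) : R :=
  (e \in H)%:R / #|H|%:R.

(* Probability of the event A for (e_1, ..., e_m) independent and uniform on H,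
   i.e. under the m-fold product of uniform_edge_pmf. *)
Definition Pr_edges (R : numFieldType) (V : finType) (H : {set {set V}})
    (m : nat) (A : pred {ffun 'I_m -> {set V}}) : R :=
  \sum_(t : {ffun 'I_m -> {set V}} | A t)
    \prod_(i < m) uniform_edge_pmf R H (t i).

(* Main.v *)
Require Import Defs.
From mathcomp Require Import all_boot all_order all_algebra.
From mathcomp Require Import all_classical all_reals all_analysis.
From mathcomp Require Import ring lra.

Set Implicit Arguments.
Unset Strict Implicit.
Unset Printing Implicit Defensive.

Import Order.TTheory GRing.Theory Num.Theory.
Import numFieldNormedType.Exports.

(** The edges are colored online, with a palette of q = floor((1 + delta) r m / n)
colors: when an edge arrives, it receives one of the colors not yet used at any
of its vertices, which is possible as long as every edge of the hypergraph H
keeps a free color.  The heuristic behind the bound is that the set of vertices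
at which a given color is free behaves like a random set whose density x_i
decreases linearly, x_i = 1 - i r / (n q), after i edges.  One thus expects an
edge to have about q x_i^r free colors, and a vertex v and a color c to be
joined by about D x_i^(r-1) edges containing v that avoid c outside v.  With q
colors the density is still about delta / (1 + delta) at the end, and the
condition on b ensures that x_m^r is at least about n^(-sigma / 30), so that
both counts stay large up to the last step.

To prove that the counts follow these trajectories, imagine that the color of
each edge is uniform among its free colors.  If all counts are within a factor
1 +- eps of their predictions, then a set T of s vertices at which c is free
loses this property at a step with probability s rho_i (1 +- 3 eps), where
rho_i = r / (n q x_i) ([on_track_hit_rate]); hence each normalized count W
drifts by at most a multiple of s rho_i eps.  If the tolerance eps_i grows
geometrically at the matching speed, then each exp(lam (+-(W - 1) - eps_i)) is
a supermartingale ([upper_potential_step], [lower_potential_step]), because a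
single step changes a count by little: by at most 1 for the free colors of an
edge, and by at most r times the maximal codegree for the other family.  As the
total growth of eps_i is at most n^(5 sigma / 28), starting from n^(-sigma / 3) keeps
it small.

The sum of all these exponentials is a potential which is at least 1 as soon
as some count leaves its range, and which is tiny at the start.  Color choices
need not be random: averaged over the next edge and its free colors, the
potential does not increase, and a best color for each edge does at least as
well as a random one.  Induction on the number of remaining edges then
bounds the probability, over the edges only, that the coloring gets stuck by
the initial potential ([Pr_not_completable_le]).  What remains is to compare
this initial value, at most m^(3 r) exp(- n^(25 sigma / 84) / (16 r)), with
m^(- r log n). *)

Local Open Scope ring_scope.

(** * Online colorings *)

(** A state [U] of the coloring records, for each color, the set of vertices
incident to an edge of that color. *)
Definition color_with (V : finType) (q : nat) (U : 'I_q -> {set V}) (c : 'I_q)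
    (e : {set V}) : 'I_q -> {set V} :=
  fun d => if d == c then U d :|: e else U d.

Definition free_colors (V : finType) (q : nat) (U : 'I_q -> {set V})
    (e : {set V}) : {set 'I_q} :=
  [set c | [disjoint e & U c]]%SET.

Fixpoint completable (V : finType) (q : nat) (U : 'I_q -> {set V})
    (es : seq {set V}) : bool :=
  if es is e :: es' then
    [exists c in free_colors U e, completable (color_with U c e) es']
  else true.

Lemma completable_coloring (V : finType) (q m : nat) (U : 'I_q -> {set V})
    (t : {ffun 'I_m -> {set V}}) :
  completable U (codom t) ->
  exists c : 'I_m -> 'I_q,
    (forall i, [disjoint t i & U (c i)]) /\
    (forall i j, i != j -> ~~ [disjoint t i & t j] -> c i != c j).
Proof.
elim: m U t => [|m IHm] U t.
  by move=> _; exists (fun i : 'I_0 => False_rect _ (notF (valP i))); split=> -[].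
rewrite /codom /image_mem enum_ordSl /= => /exists_inP[c0].
rewrite inE => c0P; rewrite -map_comp => Hc.
pose t' : {ffun 'I_m -> {set V}} := [ffun j => t (lift ord0 j)].
have Et' : codom t' = [seq (t \o lift ord0) i | i <- enum 'I_m].
  by apply: eq_map => j; rewrite ffunE.
have [c [c1 c2]] := IHm _ t' (eq_ind_r (fun s => completable _ s) Hc Et').
have c1t j : [disjoint t (lift ord0 j) & color_with U c0 (t ord0) (c j)].
  by have := c1 j; rewrite ffunE.
have c0N j : ~~ [disjoint t ord0 & t (lift ord0 j)] -> c0 != c j.
  move=> Hd; apply: contra Hd => /eqP E; move: (c1t j).
  rewrite /color_with -E eqxx disjoint_sym; apply: disjointWl.
  exact: finset.subsetUr.
exists (fun i => if unlift ord0 i is Some j then c j else c0); split.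
  move=> i; case: unliftP => [j ->|-> //].
  apply: disjointWr (c1t j); rewrite /color_with.
  by case: ifP => _; rewrite ?finset.subsetUl.
move=> i j; case: unliftP => [i' ->|->]; case: unliftP => [j' ->|->] //.
- rewrite (inj_eq lift_inj) => ij Hd; apply: c2 => //.
  by rewrite !ffunE.
- by rewrite eq_sym disjoint_sym => _ /c0N; rewrite eq_sym.
- by move=> _ /c0N.
Qed.

Lemma completable_chromatic_index (V : finType) (q m : nat)
    (t : {ffun 'I_m -> {set V}}) :
  completable (fun _ : 'I_q => finset.set0) (codom t) ->
  (chromatic_index t <= q)%N.
Proof.
move=> /completable_coloring[c [_ cP]].
rewrite /chromatic_index; case: ex_minnP => k _; apply.
apply/existsP; exists (finfun c); apply/forallP => i; apply/forallP => j.
by rewrite !ffunE; apply/implyP => /andP[]; apply: cP.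
Qed.

(** * Random edge sequences *)

Section Probability.
Variables (R : numFieldType) (V : finType) (H : {set {set V}}).

Local Notation Pr := (@Pr_edges R V H _).

Lemma Pr_edges_mono m (A B : pred {ffun 'I_m -> {set V}}) :
  (forall t, A t -> B t) -> Pr A <= Pr B.
Proof.
move=> AB; rewrite /Pr_edges [leLHS]big_mkcond [leRHS]big_mkcond /=.
apply: ler_sum => t _; case: ifP => [/AB -> //|_]; case: ifP => // _.
by apply: prodr_ge0 => i _; rewrite mulr_ge0 ?invr_ge0 ?ler0n.
Qed.

Lemma sum_uniform_edge_pmf (F : {set V} -> R) :
  \sum_e uniform_edge_pmf R H e * F e = \sum_(e in H) #|H|%:R^-1 * F e.
Proof.
rewrite [RHS]big_mkcond; apply: eq_bigr => e _; rewrite /uniform_edge_pmf.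
by case: ifP => _; rewrite ?mul1r ?mul0r.
Qed.

Lemma Pr_edges_total m : H != finset.set0 ->
  Pr (fun _ : {ffun 'I_m -> {set V}} => true) = 1.
Proof.
move=> H0; rewrite /Pr_edges -(bigA_distr_bigA (fun _ => uniform_edge_pmf R H)).
rewrite big1 // => i _; transitivity (\sum_e uniform_edge_pmf R H e * 1).
  by apply: eq_bigr => e _; rewrite mulr1.
rewrite (sum_uniform_edge_pmf (fun=> 1)) sumr_const mulr1 -[LHS]mulr_natr mulVf //.
by rewrite pnatr_eq0 cards_eq0.
Qed.

Lemma Pr_edges_compl m (A : pred {ffun 'I_m -> {set V}}) : H != finset.set0 ->
  Pr A = 1 - Pr (predC A).
Proof.
move=> /(Pr_edges_total m) <-; rewrite /Pr_edges [X in X - _](bigID A) /=.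
by rewrite addrK.
Qed.

Definition ffun_cons m (e : {set V}) (t : {ffun 'I_m -> {set V}}) :
    {ffun 'I_m.+1 -> {set V}} :=
  [ffun i => if unlift ord0 i is Some j then t j else e].

Lemma codom_ffun_cons m e (t : {ffun 'I_m -> {set V}}) :
  codom (ffun_cons e t) = e :: codom t.
Proof.
rewrite /codom /image_mem enum_ordSl /= ffunE unlift_none -map_comp.
by congr (_ :: _); apply: eq_map => j /=; rewrite ffunE liftK.
Qed.

Lemma Pr_edges_recl m (A : pred {ffun 'I_m.+1 -> {set V}}) :
  Pr A = \sum_(e in H) #|H|%:R^-1 * Pr (fun t => A (ffun_cons e t)).
Proof.
rewrite -sum_uniform_edge_pmf /Pr_edges.
under [RHS]eq_bigr do rewrite big_distrr /= big_mkcond /=.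
rewrite big_mkcond pair_bigA /=.
rewrite (reindex (fun p => ffun_cons p.1 p.2)) /=; last first.
  exists (fun t => (t ord0, [ffun j => t (lift ord0 j)])) => [[e t]|t] _ /=.
    rewrite ffunE unlift_none; congr pair; apply/ffunP => j.
    by rewrite !ffunE liftK.
  by apply/ffunP => i; rewrite ffunE; case: unliftP => [j ->|->]; rewrite ?ffunE.
apply: eq_bigr => -[e t] _ /=; case: ifP => // _.
rewrite big_ord_recl ffunE unlift_none; congr (_ * _).
by apply: eq_bigr => j _; rewrite ffunE liftK.
Qed.

(** An online strategy from a potential: if [Phi] does not increase on average
over the next edge and its free colors, then for each edge some free color
does not exceed the average over colors, so the expected potential can be kept
below its initial value by choosing colors deterministically.  States of
potential at least 1 are given up, as the claimed bound is then trivial. *)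
Lemma Pr_not_completable_le q m (Phi : nat -> ('I_q -> {set V}) -> R)
    (U : 'I_q -> {set V}) :
  H != finset.set0 ->
  (forall i W, 0 <= Phi i W) ->
  (forall i W, (i < m)%N -> Phi i W < 1 ->
     (forall e, e \in H -> free_colors W e != finset.set0) /\
     \sum_(e in H) #|H|%:R^-1 * (\sum_(c in free_colors W e)
        #|free_colors W e|%:R^-1 * Phi i.+1 (color_with W c e)) <= Phi i W) ->
  (forall i W, (Phi i W < 1) || (1 <= Phi i W)) ->
  Pr (fun t : {ffun 'I_m -> {set V}} => ~~ completable U (codom t)) <= Phi 0 U.
Proof.
move=> H0 Phi0 PhiS cmp.
suff main k i W : (i + k = m)%N ->
    Pr (fun t : {ffun 'I_k -> {set V}} => ~~ completable W (codom t)) <= Phi i W.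
  exact: main.
elim: k i W => [|k IHk] i W Em.
  rewrite /Pr_edges big_pred0 ?Phi0 // => t.
  by rewrite (_ : codom t = [::]) //; apply: size0nil; rewrite size_codom card_ord.
have im : (i < m)%N by rewrite -Em addnS ltnS leq_addr.
case/orP: (cmp i W) => [lt1|ge1]; last first.
  apply: le_trans ge1; rewrite -(Pr_edges_total k.+1 H0).
  exact: Pr_edges_mono.
have [free avg] := PhiS i W im lt1.
apply: le_trans avg; rewrite Pr_edges_recl.
apply: ler_sum => e eH; apply: ler_wpM2l; first by rewrite invr_ge0 ler0n.
have n0 : (0 : R) < #|free_colors W e|%:R by rewrite ltr0n card_gt0 free.
set p := Pr _.
have -> : p = \sum_(c in free_colors W e) #|free_colors W e|%:R^-1 * p.
  by rewrite -mulr_suml sumr_const -[_ *+ _]mulr_natr mulVf ?gt_eqF ?mul1r.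
apply: ler_sum => c cW; apply: ler_wpM2l; first by rewrite ltW ?invr_gt0.
apply: le_trans (IHk i.+1 _ _); last by rewrite addSnnS.
apply: Pr_edges_mono => t; rewrite codom_ffun_cons /=; apply: contra => Hc.
by apply/exists_inP; exists c.
Qed.
End Probability.

(** * Exponential supermartingales for one step *)

Section OneStep.
Variable R : realType.
Implicit Types (x rho : R).

Lemma expRN_le_quadratic x : 0 <= x -> expR (- x) <= 1 - x + x ^+ 2.
Proof.
move=> x0; rewrite expRN; have e1 := expR_ge1Dx x.
have : (1 + x)^-1 <= 1 - x + x ^+ 2.
  by rewrite -[leLHS]mul1r ler_pdivrMr; nra.
apply: le_trans; rewrite lef_pV2 ?posrE //; first exact: expR_gt0.
lra.
Qed.

Lemma expR_le_quadratic x : 0 <= x -> x <= 1 / 2 ->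
  expR x <= 1 + x + 2 * x ^+ 2.
Proof.
move=> x0 x1; rewrite -[x in expR x]opprK expRN; have e1 := expR_ge1Dx (- x).
have : (1 - x)^-1 <= 1 + x + 2 * x ^+ 2.
  by rewrite -[leLHS]mul1r ler_pdivrMr; nra.
apply: le_trans; rewrite lef_pV2 ?posrE //; first exact: expR_gt0.
lra.
Qed.

Lemma bernoulli_ge rho s : 0 <= rho <= 1 -> 1 - s%:R * rho <= (1 - rho) ^+ s.
Proof.
move=> /andP[r0 r1]; elim: s => [|s IH]; first by rewrite expr0 mul0r subr0.
rewrite exprSr -natr1.
have p0 : 0 <= (s%:R : R) by rewrite ler0n.
have := ler_wpM2r (_ : 0 <= 1 - rho) IH; rewrite subr_ge0 => /(_ r1).
nra.
Qed.

Lemma bernoulli_le rho s : 0 <= rho <= 1 ->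
  (1 - rho) ^+ s <= 1 - s%:R * rho + (s%:R * rho) ^+ 2.
Proof.
move=> /andP[r0 r1]; elim: s => [|s IH].
  by rewrite expr0 mul0r subr0 expr0n addr0.
rewrite exprSr -natr1.
have p0 : 0 <= (s%:R : R) by rewrite ler0n.
have := ler_wpM2r (_ : 0 <= 1 - rho) IH; rewrite subr_ge0 => /(_ r1).
move/le_trans; apply.
set t := s%:R * rho; have t0 : 0 <= t by rewrite mulr_ge0.
have -> : (s%:R + 1) * rho = t + rho by rewrite /t; ring.
have := mulr_ge0 (mulr_ge0 t0 t0) r0.
have := mulr_ge0 t0 r0; nra.
Qed.


(** Here [X] is the number of objects alive, [N] its predicted value, [N * M] the
prediction for the next step, [L] the random loss of the step and [y] the
predicted fraction of losses.  The growth of the tolerance from [eps] to [eps']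
has to absorb the error [3 * eps] of the loss fraction and the second-order
term of the exponential, which is at most [eps / 8] relative to the loss
because [lam * L] is small. *)
Lemma upper_potential_step (J : finType) (p L : J -> R)
    (X N M y eps eps' lam : R) :
  (forall j, 0 <= p j) -> \sum_j p j = 1 ->
  0 < N -> 0 <= X -> 0 < lam -> 0 <= y -> y <= eps / 4 ->
  0 < eps -> eps <= 1 / 20 -> eps + 5 * y * eps <= eps' ->
  1 - y <= M -> (forall j, 0 <= L j) ->
  (forall j, lam * (L j / (N * M)) <= eps / 8) ->
  X / N <= 1 + eps -> y * (1 - 3 * eps) * X <= \sum_j p j * L j ->
  \sum_j p j * expR (lam * ((X - L j) / (N * M) - 1 - eps'))
    <= expR (lam * (X / N - 1 - eps)).
Proof.
move=> p_ge0 p_sum N_gt0 X_ge0 lam_gt0 y_ge0 y_le eps_gt0 eps_le eps_grows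
  M_ge L_ge0 L_le Wle drift.
have M_gt0 : 0 < M by lra.
set W := X / N in Wle *; set E := \sum_j p j * (L j / (N * M)).
have WM_ge0 : 0 <= W / M := divr_ge0 (divr_ge0 X_ge0 (ltW N_gt0)) (ltW M_gt0).
have WE : W = W / M * M by rewrite mulfVK ?gt_eqF.
have dE : y * (1 - 3 * eps) * (W / M) <= E.
  have -> : E = (\sum_j p j * L j) / (N * M).
    by rewrite mulr_suml; apply: eq_bigr => j _; rewrite mulrA.
  have -> : y * (1 - 3 * eps) * (W / M) = y * (1 - 3 * eps) * X / (N * M).
    by rewrite /W invfM !mulrA.
  by rewrite ler_pM2r // invr_gt0 mulr_gt0.
have WM : W / M <= 11 / 10 by rewrite ler_pdivrMr //; nra.
have ye0 := mulr_ge0 y_ge0 (ltW eps_gt0).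
have yee0 := mulr_ge0 y_ge0 (sqr_ge0 eps).
have key : W / M - (1 - eps / 8) * E - W <= eps' - eps.
  have ineq : W / M * (1 - M - (1 - eps / 8) * (1 - 3 * eps) * y) <= 5 * y * eps.
    apply: (@le_trans _ _ (W / M * (y * (4 * eps)))); last by nra.
    by apply: ler_wpM2l => //; nra.
  have : (1 - eps / 8) * (y * (1 - 3 * eps) * (W / M)) <= (1 - eps / 8) * E.
    by apply: ler_wpM2l => //; lra.
  by move: (W / M) WE ineq => w ->; lra.
have bnd j : expR (lam * ((X - L j) / (N * M) - 1 - eps')) <=
    expR (lam * (W / M - 1 - eps')) *
      (1 - lam * (1 - eps / 8) * (L j / (N * M))).
  have -> : (X - L j) / (N * M) = W / M - L j / (N * M).
    by rewrite mulrBl /W invfM mulrA.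
  have -> : lam * (W / M - L j / (N * M) - 1 - eps') =
      lam * (W / M - 1 - eps') + - (lam * (L j / (N * M))) by ring.
  rewrite expRD ler_pM2l ?expR_gt0 //.
  have u0 : 0 <= lam * (L j / (N * M)).
    exact: mulr_ge0 (ltW lam_gt0) (divr_ge0 (L_ge0 j) (ltW (mulr_gt0 N_gt0 M_gt0))).
  apply: le_trans (expRN_le_quadratic u0) _.
  by move: (L_le j) u0; move: (L j / (N * M)) => l l1 l2; nra.
apply: le_trans (ler_sum _ (fun j _ => ler_wpM2l (p_ge0 j) (bnd j))) _.
set K := expR (lam * (W / M - 1 - eps')).
have -> : \sum_j p j * (K * (1 - lam * (1 - eps / 8) * (L j / (N * M)))) =
    K * (1 - lam * (1 - eps / 8) * E).
  rewrite -[X in K * (X - _)]p_sum /E [in RHS]mulr_sumr -sumrB mulr_sumr.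
  by apply: eq_bigr => j _; ring.
apply: le_trans (ler_wpM2l (expR_ge0 _) (expR_ge1Dx _)) _.
rewrite -expRD ler_expR.
have := ler_wpM2l (ltW lam_gt0) key; lra.
Qed.

(** In this direction the second-order term of [M] counts as well; it is at most
[y] relative to the loss, hence at most [eps / 4]. *)
Lemma lower_potential_step (J : finType) (p L : J -> R)
    (X N M y eps eps' lam : R) :
  (forall j, 0 <= p j) -> \sum_j p j = 1 ->
  0 < N -> 0 <= X -> 0 < lam -> 0 <= y -> y <= eps / 4 ->
  0 < eps -> eps <= 1 / 20 -> eps + 5 * y * eps <= eps' ->
  1 - y <= M -> M <= 1 - y + y ^+ 2 -> (forall j, 0 <= L j) ->
  (forall j, lam * (L j / (N * M)) <= eps / 8) ->
  X / N <= 1 + eps -> \sum_j p j * L j <= y * (1 + 3 * eps) * X ->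
  \sum_j p j * expR (lam * (1 - eps' - (X - L j) / (N * M)))
    <= expR (lam * (1 - eps - X / N)).
Proof.
move=> p_ge0 p_sum N_gt0 X_ge0 lam_gt0 y_ge0 y_le eps_gt0 eps_le eps_grows
  M_ge M_le L_ge0 L_le Wle drift.
have M_gt0 : 0 < M by lra.
set W := X / N in Wle *; set E := \sum_j p j * (L j / (N * M)).
have WM_ge0 : 0 <= W / M := divr_ge0 (divr_ge0 X_ge0 (ltW N_gt0)) (ltW M_gt0).
have WE : W = W / M * M by rewrite mulfVK ?gt_eqF.
have dE : E <= y * (1 + 3 * eps) * (W / M).
  have -> : E = (\sum_j p j * L j) / (N * M).
    by rewrite mulr_suml; apply: eq_bigr => j _; rewrite mulrA.
  have -> : y * (1 + 3 * eps) * (W / M) = y * (1 + 3 * eps) * X / (N * M).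
    by rewrite /W invfM !mulrA.
  by rewrite ler_pM2r // invr_gt0 mulr_gt0.
have WM : W / M <= 11 / 10 by rewrite ler_pdivrMr //; nra.
have ye0 := mulr_ge0 y_ge0 (ltW eps_gt0).
have key : (1 + eps / 4) * E - W / M + W <= eps' - eps.
  have ineq : W / M * ((1 + eps / 4) * (1 + 3 * eps) * y - (1 - M)) <= 5 * y * eps.
    apply: (@le_trans _ _ (W / M * (y * (4 * eps)))); last by nra.
    by apply: ler_wpM2l => //; nra.
  have : (1 + eps / 4) * E <= (1 + eps / 4) * (y * (1 + 3 * eps) * (W / M)).
    by apply: ler_wpM2l => //; lra.
  by move: (W / M) WE ineq => w ->; lra.
have bnd j : expR (lam * (1 - eps' - (X - L j) / (N * M))) <=
    expR (lam * (1 - eps' - W / M)) *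
      (1 + lam * (1 + eps / 4) * (L j / (N * M))).
  have -> : (X - L j) / (N * M) = W / M - L j / (N * M).
    by rewrite mulrBl /W invfM mulrA.
  have -> : lam * (1 - eps' - (W / M - L j / (N * M))) =
      lam * (1 - eps' - W / M) + lam * (L j / (N * M)) by ring.
  rewrite expRD ler_pM2l ?expR_gt0 //.
  have u0 : 0 <= lam * (L j / (N * M)).
    exact: mulr_ge0 (ltW lam_gt0) (divr_ge0 (L_ge0 j) (ltW (mulr_gt0 N_gt0 M_gt0))).
  have u1 := L_le j.
  apply: le_trans (expR_le_quadratic u0 _) _; first lra.
  by move: u0 u1; move: (L j / (N * M)) => l l1 l2; nra.
apply: le_trans (ler_sum _ (fun j _ => ler_wpM2l (p_ge0 j) (bnd j))) _.
set K := expR (lam * (1 - eps' - W / M)).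
have -> : \sum_j p j * (K * (1 + lam * (1 + eps / 4) * (L j / (N * M)))) =
    K * (1 + lam * (1 + eps / 4) * E).
  rewrite -[X in K * (X + _)]p_sum /E [in RHS]mulr_sumr -big_split mulr_sumr.
  by apply: eq_bigr => j _ /=; ring.
apply: le_trans (ler_wpM2l (expR_ge0 _) (expR_ge1Dx _)) _.
rewrite -expRD ler_expR.
have := ler_wpM2l (ltW lam_gt0) key; lra.
Qed.

End OneStep.

(** * Loss rates *)

Section Rates.
Variables (R : realFieldType) (V : finType) (q : nat) (H : {set {set V}}).
Implicit Types (U : 'I_q -> {set V}) (T : {set V}) (c : 'I_q).

(** The probability of a step (e, c) for which c is free at e, when e is uniform
in [H] and c is uniform among the free colors of e. *)
Definition step_weight U (e : {set V}) : R :=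
  #|H|%:R^-1 * #|free_colors U e|%:R^-1.

Definition step_law U (j : {set V} * 'I_q) : R :=
  ((j.1 \in H) && (j.2 \in free_colors U j.1))%:R * step_weight U j.1.

(** The probability that the next step uses the color [c] on an edge meeting [T]. *)
Definition hit_rate U c T : R :=
  \sum_(g in H | (c \in free_colors U g) && ~~ [disjoint T & g]) step_weight U g.

Lemma step_weight_ge0 U e : 0 <= step_weight U e.
Proof. by rewrite mulr_ge0 ?invr_ge0 ?ler0n. Qed.

Lemma step_law_ge0 U j : 0 <= step_law U j.
Proof. by rewrite mulr_ge0 ?ler0n ?step_weight_ge0. Qed.

Lemma step_lawE U (F : {set V} -> 'I_q -> R) :
  \sum_(e in H) #|H|%:R^-1 * (\sum_(c in free_colors U e)
     #|free_colors U e|%:R^-1 * F e c) =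
  \sum_j step_law U j * F j.1 j.2.
Proof.
rewrite -(pair_bigA _ (fun e c => step_law U (e, c) * F e c)) /= big_mkcond /=.
apply: eq_bigr => e _; rewrite /step_law /=; case: (e \in H) => /=; last first.
  by rewrite big1 // => c _; rewrite !mul0r.
rewrite mulr_sumr big_mkcond; apply: eq_bigr => c _.
by case: ifP => _; rewrite ?mul0r // mul1r mulrA.
Qed.

Lemma step_law_sum U : H != finset.set0 ->
  (forall e, e \in H -> free_colors U e != finset.set0) ->
  \sum_j step_law U j = 1.
Proof.
move=> H0 free; transitivity (\sum_j step_law U j * 1).
  by apply: eq_bigr => j _; rewrite mulr1.
rewrite -(step_lawE U (fun _ _ => 1)).
transitivity (\sum_(e in H) (#|H|%:R^-1 : R)); last first.
  by rewrite sumr_const -[LHS]mulr_natr mulVf // pnatr_eq0 cards_eq0.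
apply: eq_bigr => e /free fe; rewrite sumr_const mulr1 -[X in _ * X]mulr_natr.
by rewrite mulVf ?mulr1 // pnatr_eq0 cards_eq0.
Qed.

(** Both tracked counts have the same form: objects [i], each with a vertex set
[S i] and a color [col i], are alive as long as that color is free on that set. *)
Section Alive.
Variables (I : finType) (P : {set I}) (S : I -> {set V}) (col : I -> 'I_q).

Definition alive U : {set I} := [set i in P | [disjoint S i & U (col i)]]%SET.

Definition killed U (e : {set V}) c : {set I} :=
  [set i in alive U | (col i == c) && ~~ [disjoint S i & e]]%SET.

Lemma card_alive_color_with U e c :
  (#|alive (color_with U c e)| + #|killed U e c| = #|alive U|)%N.
Proof.
rewrite addnC -(cardsID (killed U e c) (alive U)); congr (_ + _)%N.
  by apply: eq_card => i; rewrite !inE; case: (i \in P); case: disjoint.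
apply: eq_card => i; rewrite !inE /color_with; case: (i \in P) => //=.
case: (col i == c) => /=; last by rewrite andbF.
have -> : [disjoint S i & U (col i) :|: e] =
    [disjoint S i & U (col i)] && [disjoint S i & e].
  rewrite -!setI_eq0 finset.setIUr.
  by rewrite finset.setU_eq0.
by case: [disjoint S i & U (col i)]; case: [disjoint S i & e].
Qed.

Lemma expected_killed U :
  \sum_j step_law U j * #|killed U j.1 j.2|%:R =
  \sum_(i in alive U) hit_rate U (col i) (S i).
Proof.
transitivity (\sum_j \sum_(i in alive U) step_law U j *
    ((col i == j.2) && ~~ [disjoint S i & j.1])%:R).
  apply: eq_bigr => j _; rewrite -mulr_sumr; congr (_ * _).
  rewrite -sum1_card natr_sum big_mkcond [RHS]big_mkcond; apply: eq_bigr => i _.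
  by rewrite inE; case: (i \in alive U) => //=; case: (_ && _).
rewrite exchange_big; apply: eq_bigr => i _ /=.
rewrite -(pair_bigA _ (fun e c => step_law U (e, c) *
  ((col i == c) && ~~ [disjoint S i & e])%:R)) /= /hit_rate [RHS]big_mkcond /=.
apply: eq_bigr => e _; rewrite (bigD1 (col i)) //= eqxx big1 ?addr0 => [|c].
  rewrite /step_law /=; case: (e \in H) => /=; last by rewrite !mul0r.
  by case: (_ \in _); case: [disjoint _ & _]; rewrite /= ?mul0r ?mulr0 ?mul1r ?mulr1.
by rewrite eq_sym => /negPf ->; rewrite mulr0.
Qed.

End Alive.

Lemma hit_rate_sum U c T :
  hit_rate U c T =
  \sum_(g in H | c \in free_colors U g) (T :&: g != finset.set0)%:R * step_weight U g.
Proof.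
rewrite /hit_rate big_mkcondr [RHS]big_mkcond [LHS]big_mkcond /=.
apply: eq_bigr => g _; rewrite -setI_eq0; case: (g \in H) => //=.
case: (c \in _) => //=.
by case: (T :&: g == finset.set0); rewrite ?mul0r ?mul1r.
Qed.

Lemma sum_hit_rate1 U c T :
  \sum_(w in T) hit_rate U c [set w]%SET =
  \sum_(g in H | c \in free_colors U g) #|T :&: g|%:R * step_weight U g.
Proof.
under eq_bigr do rewrite hit_rate_sum.
rewrite exchange_big; apply: eq_bigr => g _ /=.
rewrite -mulr_suml -sum1_card natr_sum; congr (_ * _).
rewrite big_mkcond [RHS]big_mkcond; apply: eq_bigr => w _.
rewrite inE; case: (w \in T) => //=.
by rewrite setI_eq0 disjoints1 negbK; case: (w \in g).
Qed.

(** A union bound over the vertices of [T]; the pair rates in [sum_hit_rate1_le]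
bound what it counts too often. *)
Lemma hit_rate_le_sum U c T :
  hit_rate U c T <= \sum_(w in T) hit_rate U c [set w]%SET.
Proof.
rewrite sum_hit_rate1 hit_rate_sum; apply: ler_sum => g _.
apply: ler_wpM2r; first exact: step_weight_ge0.
by rewrite ler_nat -card_gt0; case: #|_|.
Qed.

Definition pair_rate U c (u w : V) : R :=
  \sum_(g in H | (c \in free_colors U g)) ((u \in g) && (w \in g))%:R * step_weight U g.

Lemma sum_hit_rate1_le U c T :
  \sum_(w in T) hit_rate U c [set w]%SET <=
  hit_rate U c T + \sum_(u in T) \sum_(w in T | w != u) pair_rate U c u w.
Proof.
have -> : \sum_(u in T) \sum_(w in T | w != u) pair_rate U c u w =
    \sum_(g in H | c \in free_colors U g)
       (#|T :&: g| * #|T :&: g|.-1)%:R * step_weight U g.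
  rewrite /pair_rate; under eq_bigr do rewrite exchange_big.
  rewrite exchange_big; apply: eq_bigr => g _ /=.
  under eq_bigr do rewrite -mulr_suml.
  rewrite -mulr_suml; congr (_ * _).
  transitivity (\sum_(u in T :&: g) (#|T :&: g|.-1)%:R : R); last first.
    by rewrite sumr_const natrM mulr_natl.
  rewrite [RHS]big_mkcond [LHS]big_mkcond; apply: eq_bigr => u _ /=.
  rewrite inE; case uT: (u \in T) => //=; case ug: (u \in g) => /=; last first.
    by rewrite big1.
  rewrite (cardsD1 u) inE uT ug /= -sum1_card natr_sum.
  rewrite [RHS]big_mkcond [LHS]big_mkcond; apply: eq_bigr => w _ /=.
  by rewrite !inE andbC; case: (w != u); case: (w \in T); case: (w \in g).
rewrite sum_hit_rate1 hit_rate_sum -big_split; apply: ler_sum => g _ /=.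
rewrite -mulrDl; apply: ler_wpM2r; first exact: step_weight_ge0.
(* k <= [k > 0] + k (k - 1) for k the number of vertices of T in g *)
rewrite -natrD ler_nat -card_gt0; case: #|_| => //= k.
by rewrite mulSn addnA leq_addr.
Qed.

Definition star (v : V) : {set {set V}} := [set f in H | v \in f]%SET.

(** The vertex v itself is left out, so that this count does not collapse when v
receives the color c. *)
Definition star_alive U c v : {set {set V}} :=
  alive (star v) (fun f => f :\ v) (fun=> c) U.

Lemma hit_rate1 U c v : v \notin U c ->
  hit_rate U c [set v]%SET = \sum_(g in star_alive U c v) step_weight U g.
Proof.
move=> vU; rewrite /hit_rate [RHS]big_mkcond [LHS]big_mkcond; apply: eq_bigr => g _.
rewrite !inE disjoints1 negbK; case: (g \in H) => //=.
rewrite andbC; case: (v \in g) => //=; congr (if _ then _ else _).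
rewrite -!setI_eq0; congr (_ == _); apply/finset.setP => x; rewrite !inE.
by case: eqP => //= ->; rewrite (negPf vU) andbF.
Qed.

(** For a vertex at which c is free, the edges that can bring c to it are exactly
those counted by [star_alive]; so bounds on the two tracked counts and on the
codegrees control all hit rates. *)
Section Bounds.
Variables (U : 'I_q -> {set V}) (lo hi ylo yhi cd : R).
Hypotheses (lo_gt0 : 0 < lo)
  (freeP : forall e, e \in H -> lo <= #|free_colors U e|%:R <= hi)
  (starP : forall c v, ylo <= #|star_alive U c v|%:R <= yhi)
  (codegP : forall u v : V, u != v -> (hcodeg H u v)%:R <= cd).

Let wt_le e : e \in H -> step_weight U e <= #|H|%:R^-1 / lo.
Proof.
move=> /freeP/andP[l _]; apply: ler_wpM2l; first by rewrite invr_ge0.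
by rewrite lef_pV2 ?posrE //; apply: lt_le_trans l.
Qed.

Let wt_ge e : e \in H -> #|H|%:R^-1 / hi <= step_weight U e.
Proof.
move=> /freeP/andP[l h]; apply: ler_wpM2l; first by rewrite invr_ge0.
have l0 := lt_le_trans lo_gt0 l.
by rewrite lef_pV2 ?posrE // (lt_le_trans l0 h).
Qed.

Let star_inH g c v : g \in star_alive U c v -> g \in H.
Proof. by rewrite !inE => /andP[/andP[]]. Qed.

Lemma hit_rate1_le c v : v \notin U c ->
  hit_rate U c [set v]%SET <= yhi * (#|H|%:R^-1 / lo).
Proof.
move=> vU; rewrite hit_rate1 //.
apply: le_trans (ler_sum _ (fun g gS => wt_le (star_inH gS))) _.
rewrite sumr_const -[leLHS]mulr_natl; apply: ler_wpM2r.
  by rewrite divr_ge0 ?invr_ge0 // ltW.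
by have /andP[] := starP c v.
Qed.

Lemma hit_rate1_ge c v : 0 <= hi -> v \notin U c ->
  ylo * (#|H|%:R^-1 / hi) <= hit_rate U c [set v]%SET.
Proof.
move=> hi0 vU; rewrite hit_rate1 //.
apply: le_trans (ler_sum _ (fun g gS => wt_ge (star_inH gS))).
rewrite sumr_const -[leRHS]mulr_natl; apply: ler_wpM2r.
  by rewrite divr_ge0 ?invr_ge0.
by have /andP[] := starP c v.
Qed.

Lemma pair_rate_le c u w : u != w -> pair_rate U c u w <= cd * (#|H|%:R^-1 / lo).
Proof.
move=> uw; apply: (@le_trans _ _ (\sum_(g in [set e in H | [set u; w] \subset e]%SET)
    #|H|%:R^-1 / lo)).
  rewrite /pair_rate [leRHS]big_mkcond [leLHS]big_mkcond.
  apply: ler_sum => g _; rewrite inE finset.subUset !finset.sub1set.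
  case gH: (g \in H) => //=; have w0 := step_weight_ge0 U g.
  have l0 : 0 <= #|H|%:R^-1 / lo by rewrite divr_ge0 ?invr_ge0 // ltW.
  case: (_ \in free_colors _ _); case: (_ && _); rewrite ?mul0r ?mul1r //.
  exact: wt_le.
rewrite sumr_const -[leLHS]mulr_natl; apply: ler_wpM2r; last exact: codegP.
by rewrite divr_ge0 ?invr_ge0 // ltW.
Qed.

Lemma hit_rate_le c T : [disjoint T & U c] ->
  hit_rate U c T <= #|T|%:R * (yhi * (#|H|%:R^-1 / lo)).
Proof.
move=> dT; apply: le_trans (hit_rate_le_sum _ _ _) _.
rewrite mulr_natl -sumr_const; apply: ler_sum => v vT.
by apply: hit_rate1_le; rewrite (disjointFr dT).
Qed.

Lemma hit_rate_ge c T : 0 <= hi -> 0 <= cd -> [disjoint T & U c] ->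
  #|T|%:R * (ylo * (#|H|%:R^-1 / hi)) -
    #|T|%:R ^+ 2 * (cd * (#|H|%:R^-1 / lo)) <= hit_rate U c T.
Proof.
move=> hi0 cd0 dT; rewrite lerBlDr.
apply: (@le_trans _ _ (\sum_(w in T) hit_rate U c [set w]%SET)).
  rewrite mulr_natl -sumr_const; apply: ler_sum => v vT.
  by apply: hit_rate1_ge; rewrite // (disjointFr dT).
apply: le_trans (sum_hit_rate1_le _ _ _) _; rewrite lerD2l.
have l0 : 0 <= cd * (#|H|%:R^-1 / lo).
  by rewrite mulr_ge0 // divr_ge0 ?invr_ge0 // ltW.
rewrite expr2 -mulrA mulr_natl -sumr_const; apply: ler_sum => u _.
rewrite mulr_natl -sumr_const big_mkcondr; apply: ler_sum => w _.
by case: eqVneq => //= wu; apply: pair_rate_le; rewrite eq_sym.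
Qed.

End Bounds.
End Rates.

(** * The potential along the process *)

Section Core.
Variables (R : realType) (V : finType) (H : {set {set V}}) (r m q : nat).
(* nu is the relative error of the degrees and bounds the codegrees, A bounds the
   inverse x_m^(-r) of the final density of free colors, eps0 and tau are the
   initial tolerance and its growth rate, lam is the scale of the exponentials. *)
Variables (D nu A eps0 tau lam : R).
Local Notation n := (#|V|).

Definition free_fraction (i : nat) : R := 1 - i%:R * (r%:R / (n%:R * q%:R)).
Local Notation x := free_fraction.

(** The predicted probability that a given color, free at a given vertex, is no
longer free there after the next step; it is chosen so that
[x i.+1 = x i * (1 - hazard i)]. *)
Definition hazard (i : nat) : R := r%:R / (n%:R * q%:R * x i).
Local Notation rho := hazard.
Definition tolerance (i : nat) : R := eps0 * (1 + tau) ^+ i.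
Local Notation eps := tolerance.

Hypotheses (r_gt0 : (0 < r)%N) (n_gt0 : (0 < n)%N) (q_gt0 : (0 < q)%N).
Hypotheses (D_gt0 : 0 < D) (nu_ge0 : 0 <= nu).
Hypothesis H_uniform : uniform_hypergraph r H.
Hypothesis H_deg : forall v : V, `|(hdeg H v)%:R - D| <= nu * D.
Hypothesis H_codeg : forall u v : V, u != v -> (hcodeg H u v)%:R <= nu * D.
Hypotheses (xm_gt0 : 0 < x m) (A_ge : (x m ^+ r)^-1 <= A).
Hypotheses (eps0_gt0 : 0 < eps0) (tau_ge : 5 * (r%:R * rho m) <= tau)
  (eps_m : eps m <= 1 / 20) (nu_eps : 10 * r%:R * nu * A <= eps0)
  (lam_gt0 : 0 < lam) (lam_star : lam * (r%:R * nu * A) <= eps0 / 8)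
  (lam_free : lam * (A / q%:R) <= eps0 / 8)
  (rho_eps : r%:R * rho m <= eps0 / 4).

Let nR_gt0 : 0 < n%:R :> R. Proof. by rewrite ltr0n. Qed.
Let qR_gt0 : 0 < q%:R :> R. Proof. by rewrite ltr0n. Qed.
Let rR_gt0 : 0 < r%:R :> R. Proof. by rewrite ltr0n. Qed.
Let step_gt0 : 0 < r%:R / (n%:R * q%:R) :> R.
Proof. by rewrite divr_gt0 ?mulr_gt0. Qed.

Let x_le1 i : x i <= 1.
Proof. by rewrite gerBl mulr_ge0 // ltW. Qed.

Let x_ge i : (i <= m)%N -> x m <= x i.
Proof. by move=> im; rewrite lerD2l lerN2 ler_pM2r // ler_nat. Qed.

Let x_gt0 i : (i <= m)%N -> 0 < x i.
Proof. by move=> /x_ge; apply: lt_le_trans. Qed.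

Let x_succ i : (i <= m)%N -> x i.+1 = x i * (1 - rho i).
Proof.
move=> /x_gt0 xi; rewrite /hazard invfM mulrA mulrBr mulr1 [X in _ - X]mulrC.
rewrite mulfVK ?gt_eqF // /free_fraction -natr1 mulrDl mul1r; ring.
Qed.

Let rho_ge0 i : (i <= m)%N -> 0 <= rho i.
Proof. by move=> /x_gt0 xi; rewrite divr_ge0 // !mulr_ge0 // ltW. Qed.

Let rho_le i : (i <= m)%N -> rho i <= rho m.
Proof.
move=> im; apply: ler_wpM2l => //.
rewrite lef_pV2 ?posrE ?mulr_gt0 ?x_gt0 //; apply: ler_wpM2l (x_ge im).
by rewrite mulr_ge0 // ltW.
Qed.

Let tau_ge0 : 0 <= tau.
Proof.
by apply: le_trans tau_ge; rewrite mulr_ge0 // mulr_ge0 ?ler0n // rho_ge0.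
Qed.

Let eps_ge i : eps0 <= eps i.
Proof.
by apply: ler_peMr; [exact: ltW | rewrite exprn_ege1 // lerDl].
Qed.

Let eps_gt0 i : 0 < eps i. Proof. exact: lt_le_trans (eps_ge i). Qed.

Let eps_le i : (i <= m)%N -> eps i <= 1 / 20.
Proof.
move=> im; apply: le_trans eps_m; apply: ler_wpM2l; first exact: ltW.
by apply: ler_weXn2l => //; rewrite lerDl.
Qed.

Let A_gt0 : 0 < A.
Proof. by apply: lt_le_trans A_ge; rewrite invr_gt0 exprn_gt0. Qed.

Let xpow_ge i s : (i <= m)%N -> (s <= r)%N -> A^-1 <= x i ^+ s.
Proof.
move=> im sr; apply: (@le_trans _ _ (x m ^+ r)).
  by rewrite -[leRHS]invrK lef_pV2 ?posrE ?invr_gt0 ?exprn_gt0.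
apply: (@le_trans _ _ (x i ^+ r)).
  by apply: lerXn2r; rewrite ?nnegrE ?x_ge // ltW // x_gt0.
by apply: ler_wiXn2l => //; rewrite ltW // x_gt0.
Qed.

Let A_ge1 : 1 <= A.
Proof.
have := xpow_ge (leqnn m) (leq0n r); rewrite expr0 => h.
by rewrite -[A]invrK invr_ge1 ?unitfE ?invr_eq0 ?gt_eqF // invr_gt0.
Qed.

Let density : #|H|%:R * r%:R = \sum_(v : V) (hdeg H v)%:R :> R.
Proof.
rewrite -natr_sum -natrM; congr (_%:R).
transitivity (\sum_(e in H) #|e|)%N.
  by rewrite -sum_nat_const; apply: eq_bigr => e /H_uniform.
transitivity (\sum_(e in H) \sum_(v in e) 1)%N.
  by apply: eq_bigr => e _; rewrite sum1_card.
rewrite (exchange_big_dep xpredT) //=; apply: eq_bigr => v _.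
by rewrite sum1dep_card.
Qed.

Let deg_ge v : (1 - nu) * D <= (hdeg H v)%:R.
Proof. by have := H_deg v; rewrite ler_norml => /andP[+ _]; lra. Qed.

Let deg_le v : (hdeg H v)%:R <= (1 + nu) * D.
Proof. by have := H_deg v; rewrite ler_norml => /andP[_]; lra. Qed.

Let card_H_ge : n%:R * ((1 - nu) * D) <= #|H|%:R * r%:R.
Proof.
by rewrite density mulr_natl -sumr_const; apply: ler_sum => v _; apply: deg_ge.
Qed.

Let card_H_le : #|H|%:R * r%:R <= n%:R * ((1 + nu) * D).
Proof.
by rewrite density mulr_natl -sumr_const; apply: ler_sum => v _; apply: deg_le.
Qed.

Let nu_small : r%:R * nu * A <= eps0 / 10.
Proof. by move: nu_eps; lra. Qed.

Let nu_le : nu <= eps0 / 10.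
Proof.
apply: le_trans nu_small; apply: (@le_trans _ _ (r%:R * nu)).
  by rewrite ler_peMl // ler1n.
by rewrite ler_peMr // mulr_ge0 // ler0n.
Qed.

Let H_gt0 : 0 < #|H|%:R :> R.
Proof.
suff : 0 < #|H|%:R * r%:R :> R by rewrite pmulr_lgt0.
apply: lt_le_trans card_H_ge; rewrite !mulr_gt0 //.
have h1 := nu_le; have h2 := eps_le (leq0n m).
have h3 : eps 0 = eps0 by rewrite /tolerance expr0 mulr1.
by rewrite h3 in h2; lra.
Qed.

Let H_neq0 : H != finset.set0.
Proof. by move: H_gt0; rewrite ltr0n card_gt0. Qed.

Definition on_track (i : nat) (U : 'I_q -> {set V}) :=
  (forall e, e \in H ->
     `|#|free_colors U e|%:R / (q%:R * x i ^+ r) - 1| <= eps i) /\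
  (forall c v,
     `|#|star_alive H U c v|%:R / (D * x i ^+ r.-1) - 1| <= eps i).

(** With the counts on track, a vertex where c is free is hit by c with
probability about D x^(r-1) / (|H| q x^r), which is the hazard since |H| is
about n D / r.  The overlaps cost a relative error of at most r nu A. *)
Lemma on_track_hit_rate i (U : 'I_q -> {set V}) c (T : {set V}) : (i <= m)%N -> on_track i U ->
  [disjoint T & U c] -> (#|T| <= r)%N ->
  #|T|%:R * rho i * (1 - 3 * eps i) <= hit_rate R H U c T <=
  #|T|%:R * rho i * (1 + 3 * eps i).
Proof.
move=> im [gQ gY] dT Tr; have e0 := eps_gt0 i; have e1 := eps_le im.
have e2 := eps_ge i.
have nu0 := nu_ge0; have nu1 := nu_le; have nu2 := nu_small.
have x0 := x_gt0 im.
have xr0 : 0 < x i ^+ r by rewrite exprn_gt0.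
have xr'0 : 0 < x i ^+ r.-1 by rewrite exprn_gt0.
set Q := q%:R * x i ^+ r in gQ; set Y := D * x i ^+ r.-1 in gY.
have Q0 : 0 < Q by rewrite mulr_gt0.
have Y0 : 0 < Y by rewrite mulr_gt0.
have bnd (X N : R) : 0 < N -> `|X / N - 1| <= eps i ->
    (1 - eps i) * N <= X <= (1 + eps i) * N.
  move=> N0; rewrite ler_norml => /andP[h1 h2].
  apply/andP; split; first by rewrite -ler_pdivlMr //; lra.
  by rewrite -ler_pdivrMr //; lra.
have lo0 : 0 < (1 - eps i) * Q by rewrite mulr_gt0 //; lra.
have hi0 : 0 < (1 + eps i) * Q by rewrite mulr_gt0 //; lra.
have Qb e : e \in H -> (1 - eps i) * Q <= #|free_colors U e|%:R <= (1 + eps i) * Q.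
  by move=> /gQ; apply: bnd.
have Yb c' v : (1 - eps i) * Y <= #|star_alive H U c' v|%:R <= (1 + eps i) * Y.
  by apply: bnd.
have cd0 : 0 <= nu * D by rewrite mulr_ge0 // ltW.
have up := hit_rate_le lo0 Qb Yb dT.
have dn := hit_rate_ge lo0 Qb Yb H_codeg (ltW hi0) cd0 dT.
set h : R := #|H|%:R^-1 in up dn.
(* g is close to 1 by double counting of the incidences *)
pose g := h * D * n%:R / r%:R.
have g0 : 0 <= g by rewrite /g !mulr_ge0 ?invr_ge0 // ltW.
have gE : g * (#|H|%:R * r%:R) = n%:R * D.
  by rewrite /g /h; field; rewrite !gt_eqF.
have nD0 : 0 < n%:R * D by rewrite mulr_gt0.
have g_le : g * (1 - nu) <= 1.
  have := ler_wpM2l g0 card_H_ge; rewrite gE mulrCA mulrA => hh.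
  rewrite -(ler_pM2r nD0) mul1r; apply: le_trans hh; rewrite le_eqVlt; apply/orP; left.
  by apply/eqP; ring.
have g_ge : 1 <= g * (1 + nu).
  have := ler_wpM2l g0 card_H_le; rewrite gE mulrCA mulrA => hh.
  rewrite -(ler_pM2r nD0) mul1r; apply: (le_trans hh); rewrite le_eqVlt; apply/orP; left.
  by apply/eqP; ring.
have hYQ : Y * h / Q = rho i * g.
  rewrite /Y /Q /hazard /g -{2}(prednK r_gt0) exprS; field.
  by rewrite ?gt_eqF.
have hDQ : nu * D * h / Q = rho i * g * (nu / x i ^+ r.-1).
  rewrite -hYQ /Y; field; rewrite ?gt_eqF //.
have rg0 : 0 <= rho i := rho_ge0 im.
have T0 : 0 <= #|T|%:R :> R by rewrite ler0n.
apply/andP; split.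
- apply: le_trans dn.
  have -> : #|T|%:R * ((1 - eps i) * Y * (h / ((1 + eps i) * Q))) -
     #|T|%:R ^+ 2 * (nu * D * (h / ((1 - eps i) * Q))) =
     #|T|%:R * rho i * (g * ((1 - eps i) / (1 + eps i) -
       #|T|%:R * nu / x i ^+ r.-1 / (1 - eps i))).
    transitivity (#|T|%:R * ((1 - eps i) / (1 + eps i)) * (Y * h / Q) -
       #|T|%:R ^+ 2 / (1 - eps i) * (nu * D * h / Q)).
      by field; rewrite !gt_eqF //; lra.
    rewrite hYQ hDQ; ring.
  apply: ler_wpM2l; first exact: mulr_ge0.
  have b1 : 1 - 2 * eps i <= (1 - eps i) / (1 + eps i).
    by rewrite ler_pdivlMr; nra.
  have b2 : #|T|%:R * nu / x i ^+ r.-1 / (1 - eps i) <= eps i / 9.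
    rewrite ler_pdivrMr; last lra.
    apply: (@le_trans _ _ (r%:R * nu * A)); last by nra.
    apply: ler_pM; rewrite ?mulr_ge0 ?invr_ge0 ?(ltW xr'0) //.
      by apply: ler_wpM2r; rewrite // ler_nat.
    rewrite -[A]invrK lef_pV2 ?posrE ?invr_gt0 //.
    by apply: xpow_ge; rewrite // leq_pred.
  move: b1 b2; set a := (1 - _) / _; set a' := _ / (1 - _) => b1 b2.
  have g1 : 1 - eps i / 10 <= g by nra.
  have : (1 - eps i / 10) * (1 - 2 * eps i - eps i / 9) <= g * (a - a').
    by apply: ler_pM; lra.
  by apply: le_trans; nra.
- apply: le_trans up _.
  have -> : #|T|%:R * ((1 + eps i) * Y * (h / ((1 - eps i) * Q))) =
     #|T|%:R * rho i * (g * ((1 + eps i) / (1 - eps i))).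
    transitivity (#|T|%:R * ((1 + eps i) / (1 - eps i)) * (Y * h / Q)).
      by field; rewrite !gt_eqF //; lra.
    rewrite hYQ; ring.
  apply: ler_wpM2l; first exact: mulr_ge0.
  rewrite mulrA ler_pdivrMr; last lra.
  nra.
Qed.


Definition deviation_weight (i : nat) (X N : R) : R :=
  expR (lam * (X / N - 1 - eps i)) + expR (lam * (1 - eps i - X / N)).
Local Notation dev := deviation_weight.

Lemma deviation_weight_lt1 i X N : dev i X N < 1 -> `|X / N - 1| <= eps i.
Proof.
have lt1 y : expR (lam * y) < 1 -> y <= 0.
  by rewrite -expR0 ltr_expR pmulr_rlt0 // => /ltW.
rewrite /deviation_weight => h.
have h1 := expR_gt0 (lam * (X / N - 1 - eps i)).
have h2 := expR_gt0 (lam * (1 - eps i - X / N)).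
have /lt1 u1 : expR (lam * (X / N - 1 - eps i)) < 1 by lra.
have /lt1 u2 : expR (lam * (1 - eps i - X / N)) < 1 by lra.
by rewrite ler_norml; apply/andP; split; lra.
Qed.

Lemma deviation_weight_ge0 i X N : 0 <= dev i X N.
Proof. by rewrite addr_ge0 ?expR_ge0. Qed.

Lemma alive_deviation_step (I : finType) (P : {set I}) (S : I -> {set V})
    (col : I -> 'I_q) (X0 : R) (s i : nat) (U : 'I_q -> {set V}) :
  (i < m)%N -> on_track i U -> (forall e, e \in H -> free_colors U e != finset.set0) ->
  (s <= r)%N -> 0 < X0 -> (forall j, j \in P -> #|S j| = s) ->
  (forall e c, e \in H -> lam * (#|killed P S col U e c|%:R * (A / X0)) <= eps0 / 8) ->
  `|#|alive P S col U|%:R / (X0 * x i ^+ s) - 1| <= eps i ->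
  \sum_j step_law R H U j *
     dev i.+1 #|alive P S col (color_with U j.2 j.1)|%:R (X0 * x i.+1 ^+ s)
  <= dev i #|alive P S col U|%:R (X0 * x i ^+ s).
Proof.
move=> im gU free sr X00 cS killB Wi; have im' := ltnW im.
(* Steps (e, c) with e outside H have probability 0, but their losses are not
   bounded by the codegrees; they are set to 0. *)
pose L j : R := (j.1 \in H)%:R * #|killed P S col U j.1 j.2|%:R.
set N := X0 * x i ^+ s in Wi *; pose M := (1 - rho i) ^+ s.
have NM : X0 * x i.+1 ^+ s = N * M by rewrite x_succ // exprMn mulrA.
set X : R := #|alive P S col U|%:R in Wi *.
have EX j : step_law R H U j *
    dev i.+1 #|alive P S col (color_with U j.2 j.1)|%:R (N * M) =
    step_law R H U j * dev i.+1 (X - L j) (N * M).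
  rewrite /step_law /L; case: (j.1 \in H) => /=; last by rewrite !mul0r.
  by rewrite mul1r /X -(card_alive_color_with P S col U j.1 j.2) natrD addrK.
rewrite NM; under eq_bigr do rewrite EX.
rewrite /deviation_weight; under eq_bigr do rewrite mulrDr.
rewrite big_split /=.
have p0 := step_law_ge0 R H U; have p1 := step_law_sum R H_neq0 free.
have N0 : 0 < N by rewrite mulr_gt0 ?exprn_gt0 ?x_gt0.
have rho1 : 0 <= rho i <= 1.
  rewrite rho_ge0 //=; apply: le_trans (rho_le im') _.
  apply: (@le_trans _ _ (r%:R * rho m)); first by rewrite ler_peMl ?rho_ge0 // ler1n.
  by have := eps_le (leq0n m); have := eps_ge 0; move: rho_eps; lra.
have M1 := bernoulli_ge s rho1; have M2 := bernoulli_le s rho1.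
have y0 : 0 <= s%:R * rho i by rewrite mulr_ge0 ?rho_ge0.
have yr : s%:R * rho i <= r%:R * rho m.
  by apply: ler_pM; rewrite ?ler_nat ?rho_ge0 ?rho_le.
have y1 : s%:R * rho i <= eps i / 4.
  by apply: le_trans yr _; apply: le_trans rho_eps _; have := eps_ge i; lra.
have grow : eps i + 5 * (s%:R * rho i) * eps i <= eps i.+1.
  have -> : eps i.+1 = eps i + tau * eps i by rewrite /tolerance exprSr; ring.
  rewrite lerD2l; apply: ler_wpM2r; first exact: ltW.
  by apply: le_trans tau_ge; rewrite ler_pM2l.
have L0 j : 0 <= L j by rewrite mulr_ge0.
have LB j : lam * (L j / (N * M)) <= eps i / 8.
  apply: (@le_trans _ _ (eps0 / 8)); last by have := eps_ge i; lra.
  rewrite /L; case jH: (j.1 \in H); last by rewrite !mul0r mulr0 divr_ge0 // ltW.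
  apply: le_trans (killB j.1 j.2 jH); rewrite mul1r ler_pM2l // ler_wpM2l //.
  rewrite -NM invfM mulrC; apply: ler_wpM2r; first by rewrite invr_ge0 ltW.
  rewrite -[A]invrK lef_pV2 ?posrE ?invr_gt0 ?exprn_gt0 ?x_gt0 //.
  exact: xpow_ge.
have WN : X / N <= 1 + eps i by move: Wi; rewrite ler_norml => /andP[_]; lra.
have drift_bnd : s%:R * rho i * (1 - 3 * eps i) * X <= \sum_j step_law R H U j * L j
    <= s%:R * rho i * (1 + 3 * eps i) * X.
  have -> : \sum_j step_law R H U j * L j =
      \sum_(k in alive P S col U) hit_rate R H U (col k) (S k).
    rewrite -expected_killed; apply: eq_bigr => j _; rewrite /L /step_law.
    by case: (j.1 \in H); rewrite /= ?mul0r ?mul1r.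
  have hk k : k \in alive P S col U -> s%:R * rho i * (1 - 3 * eps i) <=
      hit_rate R H U (col k) (S k) <= s%:R * rho i * (1 + 3 * eps i).
    rewrite inE => /andP[kP dk]; rewrite -(cS k kP).
    by apply: on_track_hit_rate => //; rewrite cS.
  rewrite /X !mulr_natr -!sumr_const; apply/andP.
  by split; apply: ler_sum => k /hk/andP[].
have X0' : 0 <= X by rewrite ler0n.
have /andP[r1 r2] := drift_bnd.
apply: lerD.
- exact: (upper_potential_step p0 p1 N0 X0' lam_gt0 y0 y1 (eps_gt0 i)
    (eps_le im') grow M1 L0 LB WN r1).
- exact: (lower_potential_step p0 p1 N0 X0' lam_gt0 y0 y1 (eps_gt0 i)
    (eps_le im') grow M1 M2 L0 LB WN r2).
Qed.

Definition potential (i : nat) (U : 'I_q -> {set V}) : R :=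
  \sum_(e in H) dev i #|free_colors U e|%:R (q%:R * x i ^+ r) +
  \sum_c \sum_v dev i #|star_alive H U c v|%:R (D * x i ^+ r.-1).

Lemma potential_ge0 i U : 0 <= potential i U.
Proof.
by rewrite addr_ge0 ?sumr_ge0 // => *; rewrite ?sumr_ge0 // => *;
  apply: deviation_weight_ge0.
Qed.

Lemma potential_lt1_on_track i U : potential i U < 1 -> on_track i U.
Proof.
have d0 := deviation_weight_ge0.
have s0 c : 0 <= \sum_v dev i #|star_alive H U c v|%:R (D * x i ^+ r.-1).
  exact: sumr_ge0.
move=> lt1; split=> [e eH|c v]; apply: deviation_weight_lt1.
- apply: le_lt_trans lt1; apply: ler_wpDr; first by rewrite sumr_ge0.
  by rewrite (bigD1 e) //=; apply: ler_wpDr; rewrite // sumr_ge0.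
- apply: le_lt_trans lt1; apply: ler_wpDl; first by rewrite sumr_ge0.
  rewrite (bigD1 c) //=; apply: ler_wpDr; first by rewrite sumr_ge0.
  by rewrite (bigD1 v) //=; apply: ler_wpDr; rewrite // sumr_ge0.
Qed.

Lemma on_track_free_colors i U e : (i <= m)%N -> on_track i U -> e \in H ->
  free_colors U e != finset.set0.
Proof.
move=> im [gQ _] /gQ; apply: contraTneq => ->.
rewrite cards0 mul0r sub0r normrN normr1 -ltNge.
by apply: le_lt_trans (eps_le im) _; lra.
Qed.

(** An edge f through v lost to the new edge e contains v and another vertex of e,
so codegrees limit the loss of a single step. *)
Lemma killed_star_le (U : 'I_q -> {set V}) v e c : e \in H ->
  #|killed (star H v) (fun f => f :\ v) (fun=> c) U e c|%:R <= r%:R * (nu * D) :> R.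
Proof.
move=> eH; apply: (@le_trans _ _ (\sum_(w in e | v != w) (hcodeg H v w)%:R)).
  rewrite -natr_sum ler_nat -sum1_card /hcodeg.
  under [leqRHS]eq_bigr do rewrite -sum1_card.
  rewrite (exchange_big_dep xpredT) //= big_mkcond /=; apply: leq_sum => f _.
  rewrite !inE eqxx /=; case: ifP => // /andP[/andP[/andP[fH vf] _]].
  case/pred0Pn => w /=; rewrite !inE => /andP[/andP[wv wf] we].
  by rewrite (bigD1 w) //= we eq_sym wv inE fH finset.subUset !finset.sub1set vf wf.
rewrite -(H_uniform eH) mulr_natl -sumr_const big_mkcondr.
apply: ler_sum => w _; case: ifP => [/H_codeg //|_].
by rewrite mulr_ge0 // ltW.
Qed.

Lemma potential_step i U : (i < m)%N -> potential i U < 1 ->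
  \sum_(e in H) #|H|%:R^-1 * (\sum_(c in free_colors U e)
     #|free_colors U e|%:R^-1 * potential i.+1 (color_with U c e))
  <= potential i U.
Proof.
move=> im /potential_lt1_on_track gU; have [gQ gY] := gU.
have free e : e \in H -> free_colors U e != finset.set0.
  exact: on_track_free_colors (ltnW im) gU.
rewrite (step_lawE H U (fun e c => potential i.+1 (color_with U c e))).
rewrite /potential; under eq_bigr do rewrite mulrDr !mulr_sumr.
rewrite big_split /= exchange_big /=; apply: lerD.
- apply: ler_sum => e eH.
  have freeE W : free_colors W e = alive finset.setT (fun=> e) id W.
    by apply/finset.setP => c; rewrite !inE.
  under eq_bigr do rewrite freeE.
  rewrite freeE; apply: alive_deviation_step => //.
  + by move=> *; apply: H_uniform.
  + move=> g c gH; apply: le_trans lam_free; rewrite ler_pM2l // ler_piMl //.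
      by rewrite divr_ge0 // ltW.
    rewrite lern1 -(cards1 c); apply/subset_leq_card/fintype.subsetP => d.
    by rewrite !inE => /andP[_ /andP[]].
  + by rewrite -freeE; apply: gQ.
- rewrite exchange_big /=; apply: ler_sum => c _.
  under eq_bigr do rewrite mulr_sumr.
  rewrite exchange_big /=; apply: ler_sum => v _.
  apply: alive_deviation_step => //; first exact: leq_pred.
  + by move=> f; rewrite inE => /andP[/H_uniform <- vf]; rewrite (cardsD1 v f) vf.
  + move=> e d eH; have [->|dc] := eqVneq d c; last first.
      rewrite (_ : killed _ _ _ _ _ _ = finset.set0) ?cards0 ?mul0r ?mulr0.
        by rewrite divr_ge0 // ltW.
      by apply/finset.setP => f; rewrite !inE eq_sym (negPf dc) andbF.
    apply: le_trans lam_star; rewrite ler_pM2l //.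
    have -> : r%:R * nu * A = r%:R * (nu * D) * (A / D) by field; rewrite gt_eqF.
    by apply: ler_wpM2r; [rewrite divr_ge0 // ltW | apply: killed_star_le].
  + exact: gY.
Qed.

Let U0 : 'I_q -> {set V} := fun=> finset.set0.

Lemma potential_start : potential 0 U0 <=
  (2 * #|H|%:R + 2 * (q%:R * n%:R)) * expR (- (lam * eps0 / 2)).
Proof.
have dev_start (X N : R) : 0 < N -> `|X - N| <= nu * N ->
    dev 0 X N <= 2 * expR (- (lam * eps0 / 2)).
  move=> N0 XN; have : `|X / N - 1| <= eps0 / 2.
    have -> : X / N - 1 = (X - N) / N by field; rewrite gt_eqF.
    rewrite normrM normfV (gtr0_norm N0) ler_pdivrMr //.
    apply: le_trans XN _; rewrite ler_pM2r //.
    by have := nu_le; have := eps0_gt0; lra.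
  rewrite ler_norml => /andP[w1 w2].
  rewrite /deviation_weight /tolerance expr0 mulr1 mulr_natl mulr2n.
  have -> : - (lam * eps0 / 2) = lam * (- (eps0 / 2)) by ring.
  by apply: lerD; rewrite ler_expR ler_pM2l //; lra.
have x0 : x 0 = 1 by rewrite /free_fraction mul0r subr0.
rewrite mulrDl; apply: lerD.
- rewrite [2 * _]mulrC -[leRHS]mulrA [leRHS]mulr_natl -sumr_const.
  apply: ler_sum => e eH; apply: dev_start; rewrite x0 expr1n mulr1 //.
  rewrite (_ : free_colors _ _ = finset.setT) ?cardsT ?card_ord ?subrr ?normr0.
    by rewrite mulr_ge0 // ltW.
  by apply/finset.setP => c; rewrite !inE -setI_eq0 finset.setI0 eqxx.
- apply: (@le_trans _ _ (\sum_(c < q) \sum_(v : V) 2 * expR (- (lam * eps0 / 2)))).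
    apply: ler_sum => c _; apply: ler_sum => v _; apply: dev_start.
      by rewrite x0 expr1n mulr1.
    rewrite x0 expr1n mulr1 (_ : #|_| = hdeg H v) //; apply: eq_card => f.
    by rewrite !inE -setI_eq0 finset.setI0 eqxx andbT.
  rewrite !sumr_const card_ord -[leLHS]mulr_natr -[X in X * _ <= _]mulr_natr.
  by rewrite le_eqVlt; apply/orP; left; apply/eqP; ring.
Qed.

Lemma Pr_not_completable_bound :
  Pr_edges R H (fun t : {ffun 'I_m -> {set V}} => ~~ completable U0 (codom t)) <=
  (2 * #|H|%:R + 2 * (q%:R * n%:R)) * expR (- (lam * eps0 / 2)).
Proof.
apply: le_trans potential_start; apply: Pr_not_completable_le => //.
- exact: potential_ge0.
- move=> i W im lt1; split; last exact: potential_step.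
  by move=> e; apply: on_track_free_colors (ltnW im) (potential_lt1_on_track lt1).
- by move=> i W; case: (ltP (potential i W) 1).
Qed.

End Core.

Local Open Scope classical_set_scope.
Local Open Scope ring_scope.

(** * Choice of the parameters *)

Section Asymptotics.
Variable R : realType.

Lemma powRE (x a : R) : 0 < x -> x `^ a = expR (a * ln x).
Proof. by move=> x0; rewrite /powR gt_eqF. Qed.

Lemma polynomial_le_expR (C a : R) : 0 <= C -> 0 < a ->
  exists2 L0 : R, 1 <= L0 & forall L, L0 <= L -> C * L ^+ 5 <= expR (a * L).
Proof.
move=> C0 a0; have a6 : 0 < (a / 6) ^+ 6 by rewrite exprn_gt0 // divr_gt0.
exists (1 + C / (a / 6) ^+ 6); first by rewrite lerDl divr_ge0 // ltW.
move=> L LL0; have L0 : 0 < L.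
  by apply: lt_le_trans LL0; rewrite ltr_wpDr // divr_ge0 // ltW.
have -> : a * L = 6%:R * (a * L / 6) by field.
rewrite expRM_natl; apply: (@le_trans _ _ ((a * L / 6) ^+ 6)); last first.
  apply: lerXn2r; rewrite ?nnegrE ?expR_ge0 //.
    by rewrite divr_ge0 // mulr_ge0 // ltW.
  by apply: le_trans (expR_ge1Dx _); lra.
have -> : (a * L / 6) ^+ 6 = ((a / 6) ^+ 6 * L) * L ^+ 5 by field.
apply: ler_wpM2r; first by rewrite exprn_ge0 // ltW.
rewrite mulrC -ler_pdivrMr //.
by apply: le_trans LL0; rewrite lerDr.
Qed.

Lemma cvg_ln_natr : ln (n%:R : R) @[n --> \oo] --> +oo%R.
Proof.
apply/cvgryPge => B.
have := @cvgr_idn R => /cvgryPge /(_ (expR B)).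
apply: filterS => n Bn; rewrite -[leLHS]expRK.
by rewrite ler_ln ?posrE ?expR_gt0 // (lt_le_trans (expR_gt0 B)).
Qed.

Lemma card_uniform_le (V : finType) (r : nat) (H : {set {set V}}) :
  uniform_hypergraph r H -> (#|H| <= #|V| ^ r)%N.
Proof.
move=> Hr; apply: (@leq_trans 'C(#|V|, r)).
  rewrite -card_draws; apply/subset_leq_card/fintype.subsetP => e /Hr er.
  by rewrite inE er.
have ffact_le k : (#|V| ^_ k <= #|V| ^ k)%N.
  by elim: k => // k IH; rewrite ffactnSr expnSr leq_mul // leq_subr.
by apply: leq_trans (ffact_le r); rewrite -bin_ffact leq_pmulr // fact_gt0.
Qed.

Lemma Pr_chromatic_index_ge (V : finType) (H : {set {set V}}) (m q : nat) (K P : R) :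
  H != finset.set0 -> q%:R <= K ->
  Pr_edges R H (fun t : {ffun 'I_m -> {set V}} =>
    ~~ completable (fun _ : 'I_q => finset.set0) (codom t)) <= P ->
  1 - P <= Pr_edges R H (fun t : {ffun 'I_m -> {set V}} =>
    (chromatic_index t)%:R <= K).
Proof.
move=> H0 qK PP; rewrite Pr_edges_compl // lerD2l lerN2; apply: le_trans PP.
apply: Pr_edges_mono => t /=; apply: contra => /completable_chromatic_index tq.
by apply: le_trans qK; rewrite ler_nat.
Qed.

Lemma free_fraction_last (V : finType) (r q m : nat) :
  (0 < #|V|)%N -> (0 < q)%N ->
  let mu : R := r%:R * m%:R / #|V|%:R in
  free_fraction R V r q m = (q%:R - mu) / q%:R.
Proof.
move=> V0 q0 mu; rewrite /free_fraction /mu; field.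
by rewrite !pnatr_eq0 -!lt0n q0 V0.
Qed.

(** The parameters are nu = n^(-sigma), eps0 = n^(-sigma/3), A = n^(sigma/28),
lam = eps0 / (8 r nu A), written with L = log n.  Everything rests on
w = r mu / (q - mu) with mu = r m / n, which bounds both r log(1 / x_m) and the
total sum of the hazards of an edge.  By the hypothesis on b it is at most
(sigma / 28) L, the slack between 30 and 28 paying for the rounding of q.  The
number E stands for any power of n with exponent at most sigma / 11, which
beats the polynomials in L that occur. *)
Lemma coloring_failure_bound (delta sigma b : R) (V : finType) (H : {set {set V}})
    (r m q : nat) (D : R) (n := #|V|) (L := ln (n%:R : R))
    (mu : R := r%:R * m%:R / n%:R) (E : R) :
  0 < delta -> 0 < sigma -> b <= delta * sigma / 30 ->
  (0 < n)%N -> (2 <= r)%N -> r%:R <= b * L ->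
  expR ((1 + sigma) * L) <= m%:R ->
  1 <= L ->
  (forall t : R, sigma / 11 <= t -> E <= expR (t * L)) ->
  15 <= delta * E -> 20 <= E -> 10 * b * L <= E -> sigma * L <= E ->
  0 < D -> uniform_hypergraph r H ->
  (forall v : V, `|(hdeg H v)%:R - D| <= expR (- sigma * L) * D) ->
  (forall u v : V, u != v -> (hcodeg H u v)%:R <= expR (- sigma * L) * D) ->
  (1 + delta) * mu - 1 <= q%:R ->
  Pr_edges R H (fun t : {ffun 'I_m -> {set V}} =>
    ~~ completable (fun _ : 'I_q => finset.set0) (codom t)) <=
  (2 * #|H|%:R + 2 * (q%:R * n%:R)) *
    expR (- (expR (25 * sigma / 84 * L) / (16 * r%:R))).
Proof.
move=> delta0 sigma0 bds n0 r2 rb mge L1 EP Ed E20 Eb Es D0 Hr Hdeg Hcodeg qge.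
have L0 : 0 < L by lra.
have nR0 : 0 < n%:R :> R by rewrite ltr0n.
have nE : n%:R = expR L by rewrite lnK // posrE.
have rR2 : 2 <= r%:R :> R by rewrite ler_nat.
have m0 : 0 < m%:R :> R by apply: lt_le_trans mge; apply: expR_gt0.
have mu_ge : r%:R * expR (sigma * L) <= mu.
  rewrite /mu ler_pdivlMr // -mulrA; apply: ler_wpM2l; first lra.
  by rewrite nE -expRD (_ : _ + L = (1 + sigma) * L) //; ring.
have E_sigma : E <= expR (sigma * L) by apply: EP; lra.
have mu_big : 15 <= delta * mu.
  apply: (le_trans Ed); rewrite ler_pM2l //; apply: le_trans mu_ge.
  by apply: (le_trans E_sigma); rewrite ler_peMl ?expR_ge0 //; lra.
have mu0 : 0 < mu by rewrite -(pmulr_rgt0 _ delta0); lra.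
have gap : 28 / 30 * (delta * mu) <= q%:R - mu by lra.
have gap0 : 0 < q%:R - mu by lra.
have q0R : 0 < q%:R :> R by lra.
have q0 : (0 < q)%N by rewrite -(ltr0n R).
set w := r%:R * mu / (q%:R - mu).
have w_ge0 : 0 <= w by rewrite divr_ge0 ?mulr_ge0 ?(ltW mu0) ?(ltW gap0).
have w_le : w <= sigma / 28 * L.
  rewrite /w ler_pdivrMr //.
  apply: (@le_trans _ _ (sigma / 28 * L * (28 / 30 * (delta * mu)))); last first.
    by apply: ler_wpM2l gap; rewrite mulr_ge0 ?(ltW L0) // divr_ge0 // ltW.
  have -> : sigma / 28 * L * (28 / 30 * (delta * mu)) =
    (delta * sigma / 30 * L) * mu by field.
  rewrite ler_pM2r //; apply: (le_trans rb); rewrite ler_pM2r //.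
set xm := free_fraction R V r q m.
have xmE : xm = (q%:R - mu) / q%:R by apply: free_fraction_last.
have xm0 : 0 < xm by rewrite xmE divr_gt0.
have rrho : r%:R * hazard R V r q m = w / m%:R.
  rewrite /hazard -/xm xmE /w -/n.
  have -> : r%:R * mu = r%:R * (r%:R * m%:R / n%:R) by [].
  by move: (q%:R - mu) gap0 => g g0; field; rewrite !gt_eqF.
have xm_inv : xm^-1 <= expR (mu / (q%:R - mu)).
  apply: le_trans (expR_ge1Dx _); rewrite xmE le_eqVlt; apply/orP; left.
  by apply/eqP; field; rewrite !gt_eqF.
pose eps0 := expR (- (sigma / 3) * L); pose nu := expR (- sigma * L).
pose A := expR (sigma / 28 * L); pose lam := eps0 / (8 * (r%:R * nu * A)).
have [eps00 nu0 A0] : [/\ 0 < eps0, 0 < nu & 0 < A] by split; apply: expR_gt0.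
have rnuA0 : 0 < r%:R * nu * A by rewrite !mulr_gt0 //; lra.
have A_ge : xm ^- r <= A.
  rewrite -exprVn; apply: (@le_trans _ _ (expR (mu / (q%:R - mu)) ^+ r)).
    by apply: lerXn2r; rewrite ?nnegrE ?expR_ge0 ?invr_ge0 ?(ltW xm0).
  by rewrite -expRM_natl ler_expR; move: w_le; rewrite /w mulrA.
have eps_m : tolerance eps0 (5 * (w / m%:R)) m <= 1 / 20.
  have pw : (1 + 5 * (w / m%:R)) ^+ m <= expR (5 * w).
    have -> : 5 * w = m%:R * (5 * (w / m%:R)) by field; rewrite gt_eqF.
    rewrite expRM_natl; apply: lerXn2r; rewrite ?nnegrE ?expR_ge0 ?expR_ge1Dx //.
    by rewrite addr_ge0 // mulr_ge0 // divr_ge0 // ltW.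
  rewrite /tolerance; apply: (@le_trans _ _ (eps0 * expR (5 * w))).
    by rewrite ler_pM2l.
  apply: (@le_trans _ _ (expR (sigma / 10 * L))^-1).
    rewrite -expRN -expRD ler_expR.
    by have := mulr_gt0 sigma0 L0; lra.
  have EP' := EP (sigma / 10).
  rewrite mul1r lef_pV2 ?posrE ?expR_gt0 //.
  by apply: le_trans E20 _; apply: EP'; lra.
have nu_eps : 10 * r%:R * nu * A <= eps0.
  have : 10 * r%:R <= expR (sigma / 2 * L).
    apply: (@le_trans _ _ (10 * b * L)); first by rewrite -!mulrA ler_pM2l.
    by apply: (le_trans Eb); apply: EP; lra.
  move=> h; apply: (@le_trans _ _ (expR (sigma / 2 * L) * nu * A)).
    by rewrite ler_wpM2r ?(ltW A0) // ler_wpM2r ?(ltW nu0).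
  by rewrite -!expRD ler_expR; have := mulr_gt0 sigma0 L0; lra.
have lam0 : 0 < lam by rewrite divr_gt0 // mulr_gt0.
have lam_star : lam * (r%:R * nu * A) <= eps0 / 8.
  rewrite le_eqVlt; apply/orP; left; apply/eqP; rewrite /lam.
  by field; rewrite !gt_eqF //; lra.
have lam_free : lam * (A / q%:R) <= eps0 / 8.
  apply: le_trans lam_star; rewrite ler_pM2l // [A / _]mulrC ler_pM2r //.
  rewrite -[leLHS]mul1r ler_pdivrMr //.
  apply: (@le_trans _ _ (r%:R * nu * expR (sigma * L))).
    by rewrite -mulrA -expRD mulNr addNr expR0 mulr1; apply: le_trans rR2; rewrite ler1n.
  rewrite ler_wpM2l //; first by rewrite mulr_ge0 ?(ltW nu0) // ler0n.
  have : mu <= q%:R by lra.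
  apply: le_trans; apply: le_trans mu_ge; rewrite ler_peMl ?expR_ge0 //; lra.
have rho_eps : r%:R * hazard R V r q m <= eps0 / 4.
  rewrite rrho ler_pdivrMr //.
  apply: (@le_trans _ _ (eps0 / 4 * expR (sigma * L))); last first.
    apply: ler_wpM2l; first by rewrite divr_ge0 // ltW.
    by apply: le_trans mge; rewrite ler_expR; lra.
  have : sigma * L <= expR (2 / 3 * sigma * L).
    by apply: (le_trans Es); apply: EP; lra.
  have -> : expR (2 / 3 * sigma * L) = eps0 * expR (sigma * L).
    by rewrite -expRD; congr expR; field.
  by have := mulr_gt0 sigma0 L0; lra.
have tau_ge : 5 * (r%:R * hazard R V r q m) <= 5 * (w / m%:R) by rewrite rrho.
have <- : lam * eps0 / 2 = expR (25 * sigma / 84 * L) / (16 * r%:R).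
  have -> : lam * eps0 / 2 = eps0 * eps0 * nu^-1 * A^-1 / (16 * r%:R).
    by rewrite /lam; field; rewrite !gt_eqF //; lra.
  by rewrite -!expRN -!expRD; congr (expR _ / _); field.
exact: (Pr_not_completable_bound (ltnW r2) n0 q0 D0 (ltW nu0) Hr Hdeg Hcodeg xm0
  A_ge eps00 tau_ge eps_m nu_eps lam0 lam_star lam_free rho_eps).
Qed.


(** There are at most m^(3r) terms in the potential.  As log m is at most
r n^(sigma/5) L and r at most b L, the exponent (3 + L) r log m is a polynomial
in L times n^(sigma/5), and 1/5 + 1/11 < 25/84. *)
Lemma failure_bound_le_powR (delta sigma b : R) (V : finType) (H : {set {set V}})
    (r m q : nat) (n := #|V|) (L := ln (n%:R : R)) (E := expR (sigma / 11 * L)) :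
  0 < delta -> 0 < sigma -> (0 < n)%N -> (2 <= r)%N -> r%:R <= b * L ->
  expR ((1 + sigma) * L) <= m%:R ->
  ln (m%:R : R) <= r%:R * expR (sigma / 5 * L) * L ->
  1 <= L -> 20 <= E -> 10 * b * L <= E -> 4 * (1 + delta) <= E ->
  64 * b ^+ 3 * L ^+ 5 <= E ->
  uniform_hypergraph r H ->
  q%:R <= (1 + delta) * (r%:R * m%:R / n%:R) ->
  (2 * #|H|%:R + 2 * (q%:R * n%:R)) *
    expR (- (expR (25 * sigma / 84 * L) / (16 * r%:R)))
  <= m%:R `^ (- (L * r%:R)).
Proof.
move=> delta0 sigma0 n0 r2 rb mge lnm L1 E20 Eb Ed EL Hr qle.
have L0 : 0 < L by lra.
have nR0 : 0 < n%:R :> R by rewrite ltr0n.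
have nE : n%:R = expR L by rewrite lnK // posrE.
have rR2 : 2 <= r%:R :> R by rewrite ler_nat.
have sL := mulr_gt0 sigma0 L0.
have nm : n%:R <= m%:R :> R by apply: le_trans mge; rewrite nE ler_expR; lra.
have Em : E <= m%:R by apply: le_trans mge; rewrite ler_expR; lra.
have m0 : 0 < m%:R :> R by lra.
have rm : r%:R <= m%:R :> R by lra.
have m1 : 1 <= m%:R :> R by lra.
have card_le : 2 * #|H|%:R + 2 * (q%:R * n%:R) <= m%:R ^+ (3 * r) :> R.
  have h1 : 2 * #|H|%:R <= m%:R ^+ (3 * r) / 2 :> R.
    apply: (@le_trans _ _ (m%:R ^+ r.+1 / 2)); last first.
      rewrite ler_pM2r //; apply: ler_weXn2l => //.
      by rewrite mulSn -addn1 leq_add2l muln_gt0 /= (ltnW r2).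
    have : #|H|%:R <= m%:R ^+ r :> R.
      apply: (@le_trans _ _ (n%:R ^+ r)); last by apply: lerXn2r; rewrite ?nnegrE.
      by rewrite -natrX ler_nat card_uniform_le.
    have : 0 <= m%:R ^+ r :> R by rewrite exprn_ge0.
    rewrite exprS; move: (m%:R ^+ r) => z z0 hz; nra.
  have h2 : 2 * (q%:R * n%:R) <= m%:R ^+ (3 * r) / 2 :> R.
    apply: (@le_trans _ _ (m%:R ^+ 3 / 2)); last first.
      by rewrite ler_pM2r //; apply: ler_weXn2l; rewrite // leq_pmulr // (ltnW r2).
    have : q%:R * n%:R <= (1 + delta) * (r%:R * m%:R).
      apply: (@le_trans _ _ ((1 + delta) * (r%:R * m%:R / n%:R) * n%:R)).
        by rewrite ler_pM2r.
      by rewrite !mulrA mulfVK // gt_eqF.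
    have : 4 * (1 + delta) * (r%:R * m%:R) <= m%:R * (m%:R * m%:R).
      by rewrite ler_pM ?ler_pM2r ?mulr_ge0 //; lra.
    rewrite !exprS expr0 mulr1; lra.
  lra.
apply: (@le_trans _ _ (m%:R ^+ (3 * r) *
    expR (- (expR (25 * sigma / 84 * L) / (16 * r%:R))))).
  by rewrite ler_pM2r ?expR_gt0.
rewrite powRE // -[X in X ^+ _]lnK ?posrE // -expRM_natl -expRD ler_expR natrM.
rewrite -lerBrDl mulNr; set l := ln (m%:R : R) in lnm *.
suff : (3 + L) * r%:R * l * (16 * r%:R) <= expR (25 * sigma / 84 * L).
  rewrite -ler_pdivlMr; last lra.
  by move: (expR (25 * sigma / 84 * L) / _) => z; lra.
have e0 : 0 < expR (sigma / 5 * L) := expR_gt0 _.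
apply: (@le_trans _ _ (E * expR (sigma / 5 * L))); last first.
  by rewrite -expRD ler_expR; lra.
apply: (@le_trans _ _ (64 * b ^+ 3 * L ^+ 5 * expR (sigma / 5 * L))); last first.
  by rewrite ler_pM2r.
apply: (@le_trans _ _ ((4 * L) * r%:R * (r%:R * expR (sigma / 5 * L) * L) * (16 * r%:R))).
  apply: ler_wpM2r => //.
  apply: (@le_trans _ _ ((3 + L) * r%:R * (r%:R * expR (sigma / 5 * L) * L))).
    by apply: ler_wpM2l => //; rewrite mulr_ge0 //; lra.
  apply: ler_wpM2r; first by rewrite !mulr_ge0 // ltW.
  by apply: ler_wpM2r => //; lra.
have -> : 4 * L * r%:R * (r%:R * expR (sigma / 5 * L) * L) * (16 * r%:R) =
  64 * L ^+ 2 * expR (sigma / 5 * L) * r%:R ^+ 3 by ring.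
have -> : 64 * b ^+ 3 * L ^+ 5 * expR (sigma / 5 * L) =
  64 * L ^+ 2 * expR (sigma / 5 * L) * (b * L) ^+ 3 by ring.
apply: ler_wpM2l; first by rewrite !mulr_ge0 ?exprn_ge0 // ltW.
by apply: lerXn2r; rewrite ?nnegrE //; lra.
Qed.

End Asymptotics.

Theorem theorem2 (R : realType) (delta sigma b : R)
    (hdelta : 0 < delta) (hsigma : 0 < sigma) (hb : 0 < b)
    (hbds : b <= delta * sigma / 30) :
  exists (n0 : nat) (psi : nat -> R),
    [/\ (0 < n0)%N,
        psi n @[n --> \oo] --> +oo &
        forall (n r m : nat) (D : R) (V : finType) (H : {set {set V}}),
          (n0 <= n)%N ->
          (2 <= r)%N -> r%:R <= b * ln (n%:R : R) ->
          (n%:R : R) `^ (1 + sigma) <= m%:R ->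
          (m%:R : R) <= n%:R `^ (r%:R * n%:R `^ (sigma / 5)) ->
          0 < D ->
          #|V| = n ->
          uniform_hypergraph r H ->
          (forall v : V,
             `|(hdeg H v)%:R - D| <= n%:R `^ (- sigma) * D) ->
          (forall u v : V, u != v ->
             (hcodeg H u v)%:R <= n%:R `^ (- sigma) * D) ->
          Pr_edges R H
            (fun t : {ffun 'I_m -> {set V}} =>
               (chromatic_index t)%:R
                 <= (1 + delta) * (r%:R * m%:R / n%:R) :> R)
          >= 1 - m%:R `^ (- (psi n * r%:R))].
Proof.
(* One constant dominating all the coefficients of the polynomials in L = log n
   that n^(sigma/11) has to exceed. *)
pose C := 15 / delta + 20 + 10 * b + sigma + 4 * (1 + delta) + 64 * b ^+ 3.
have d15 : 0 < 15 / delta by rewrite divr_gt0.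
have b3 : 0 < b ^+ 3 by rewrite exprn_gt0.
have C0 : 0 <= C by rewrite /C; lra.
have s11 : 0 < sigma / 11 by rewrite divr_gt0.
have [L0 L01 growth] := polynomial_le_expR C0 s11.
exists (Num.truncn (expR L0)).+1, (fun n => ln (n%:R : R)); split=> //.
  exact: cvg_ln_natr.
move=> n r m D V H n0n r2 rb mge mle D0 Vn Hr Hdeg Hcodeg.
have n0 : (0 < n)%N by apply: leq_trans n0n.
have nR0 : 0 < n%:R :> R by rewrite ltr0n.
rewrite !powRE // in mge mle Hdeg Hcodeg.
set L := ln (n%:R : R) in rb mge mle Hdeg Hcodeg *.
have L_ge : L0 <= L.
  rewrite -[L0]expRK ler_ln ?posrE ?expR_gt0 //.
  have /andP[_ /ltW h] := truncn_itv (expR_ge0 L0).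
  by apply: (le_trans h); rewrite ler_nat.
have L1 : 1 <= L := le_trans L01 L_ge.
have L5 : L <= L ^+ 5 by rewrite -[leLHS]expr1 ler_weXn2l.
set E := expR (sigma / 11 * L).
have CE : C * L ^+ 5 <= E := growth L L_ge.
have le_E5 c : c <= C -> c * L ^+ 5 <= E.
  by move=> cC; apply: le_trans CE; rewrite ler_wpM2r ?exprn_ge0 //; lra.
have le_E1 c : 0 <= c -> c <= C -> c * L <= E.
  by move=> c0 cC; apply: le_trans (le_E5 c cC); rewrite ler_wpM2l.
have le_E0 c : 0 <= c -> c <= C -> c <= E.
  by move=> c0 cC; apply: le_trans (le_E1 c c0 cC); rewrite ler_peMr.
have E1 : 15 / delta <= E by apply: le_E0; rewrite /C; lra.
have E2 : 20 <= E by apply: le_E0; rewrite /C; lra.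
have E3 : 10 * b * L <= E by apply: le_E1; rewrite /C; lra.
have E4 : sigma * L <= E by apply: le_E1; rewrite /C; lra.
have E5 : 4 * (1 + delta) <= E by apply: le_E0; rewrite /C; lra.
have E6 : 64 * b ^+ 3 * L ^+ 5 <= E by apply: le_E5; rewrite /C; lra.
have E1' : 15 <= delta * E by rewrite mulrC -ler_pdivrMr.
have EP t : sigma / 11 <= t -> E <= expR (t * L).
  by move=> ht; rewrite ler_expR ler_wpM2r //; lra.
have m0 : 0 < m%:R :> R by apply: lt_le_trans mge; apply: expR_gt0.
have lnm : ln (m%:R : R) <= r%:R * expR (sigma / 5 * L) * L.
  by rewrite -[leRHS]expRK ler_ln ?posrE ?expR_gt0.
set K := (1 + delta) * (r%:R * m%:R / n%:R).
have K0 : 0 <= K by rewrite /K !mulr_ge0 ?invr_ge0 // ltW //; lra.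
have /andP[qle qgt] := truncn_itv K0.
set q := Num.truncn K in qle qgt.
have qge : K - 1 <= q%:R by rewrite lerBlDr natr1 ltW.
subst n.
have H_neq0 : H != finset.set0.
  have [v _] := card_gt0P n0; apply/negP => /eqP HE.
  have := Hdeg v; rewrite /hdeg HE (_ : #|_| = 0%N); last first.
    by apply: eq_card0 => e; rewrite !inE.
  rewrite sub0r normrN gtr0_norm // ler_pMl // -expR0 ler_expR.
  by have := mulr_gt0 hsigma (lt_le_trans ltr01 L1); lra.
apply: (@Pr_chromatic_index_ge R V H m q) => //.
apply: le_trans (coloring_failure_bound hdelta hsigma hbds n0 r2 rb mge L1 EP
  E1' E2 E3 E4 D0 Hr Hdeg Hcodeg qge) _.
exact: (failure_bound_le_powR hdelta hsigma n0 r2 rb mge lnm L1 E2 E3 E5 E6 Hr qle).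
Qed.
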